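(* Let $m\ge 3$ and $M=\{1,2,\dots,m-1\}$. The assignment $S_U\mapsto M_U$ is a bijection from the set of Schubert unions in $G(2,m)$ (with respect to a fixed flag, the empty set included) to the power set $P(M)$; in particular there are exactly $2^{m-1}$ Schubert unions in $G(2,m)$. Moreover, duality of Schubert unions corresponds to complementation: for every Schubert union $S_U$ one has $M_{U^*}=M\setminus M_U$.
   Context: Let $V$ be an $m$-dimensional vector space over a field $F$ with basis $e_1,\dots,e_m$, $A_i=\mathrm{Span}(e_1,\dots,e_i)$, and let $G(2,m)$ be the Grassmann variety of $2$-dimensional subspaces of $V$. Let $G_{G(2,m)}=\{(x,y)\in\mathbf Z^2:1\le x<y\le m\}$. For $(a,b)\in G_{G(2,m)}$ the Schubert cycle is $S_{(a,b)}=\{W\in G(2,m):\dim(W\cap A_a)\ge1,\ W\subset A_b\}$, with grid $G_{(a,b)}=\{(x,y)\in G_{G(2,m)}:x\le a,\ y\le b\}$. A Schubert union is a finite union $S_U=\bigcup_iS_{\alpha_i}$ (possibly empty), with grid $G_U=\bigcup_iG_{\alpha_i}$; put $H_U=G_{G(2,m)}\setminus G_U$. The subset $M_U\subset M$ is $\{m_1,\dots,m_r\}$ if there are exactly $m_i$ points $(x,y)\in G_U$ with $x=i$, for $i=1,\dots,r$ (each $m_i\geq 1$), and no points with $x=i$ for $i>r$; one has $m_1>m_2>\dots>m_r$. The dual $S_{U^*}$ of $S_U$ is the Schubert union, in the Grassmannian $G(2,m)^*$ of $2$-dimensional subspaces of $V^*$ with respect to the dual flag $A_m^\bot\subset\dots\subset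 A_1^\bot\subset V^*$ ($A_i^\bot$ the annihilator of $A_i$), whose grid is $G_{U^*}=\{(m+1-b,m+1-a):(a,b)\in H_U\}$; $M_{U^*}$ is defined from $G_{U^*}$ in the same way. *)

(* Defs.v *)
From HB Require Import structures.
From mathcomp Require Import all_boot all_order all_algebra.
From mathcomp Require Import mathcomp_extra boolp classical_sets functions.
From mathcomp Require Import cardinality.

Set Implicit Arguments.
Unset Strict Implicit.
Unset Printing Implicit Defensive.

Import GRing.Theory.

Local Open Scope nat_scope.

(* Pairs (x, y) with 0 <= x, y <= m: grid coordinates are 1-based and are the
   actual values of the ordinals. *)
Notation grid_point m := ('I_m.+1 * 'I_m.+1)%type.

Definition full_grid (m : nat) : {set grid_point m} :=
  [set p : grid_point m | 1 <= p.1 < p.2]%SET.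

Definition cycle_grid (m : nat) (alpha : grid_point m) : {set grid_point m} :=
  [set p in full_grid m | (p.1 <= alpha.1) && (p.2 <= alpha.2)]%SET.

Definition union_grid (m : nat) (U : {set grid_point m}) : {set grid_point m} :=
  (\bigcup_(alpha in U) cycle_grid alpha)%SET.

Definition dual_grid (m : nat) (G : {set grid_point m}) : {set grid_point m} :=
  [set p : grid_point m | [exists q in full_grid m :\: G,
     (p.1 == m.+1 - q.2 :> nat) && (p.2 == m.+1 - q.1 :> nat)]]%SET.

Definition column (m : nat) (G : {set grid_point m}) (i : nat) : nat :=
  #|[set p in G | p.1 == i :> nat]%SET|.

(* The set {m_1, ..., m_r}, where m_i = column G i is positive for
   1 <= i <= r and zero for i > r. *)
Definition column_set (m : nat) (G : {set grid_point m}) : {set 'I_m.+1} :=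
  [set k : 'I_m.+1 | [exists r : 'I_m.+1,
     [&& [forall i : 'I_m.+1, (1 <= i <= r) ==> (1 <= column G i)],
         [forall i : 'I_m.+1, (r < i) ==> (column G i == 0)]
       & [exists i : 'I_m.+1, (1 <= i <= r) && (k == column G i :> nat)]]]]%SET.

Definition M_full (m : nat) : {set 'I_m.+1} :=
  [set k : 'I_m.+1 | 1 <= k <= m - 1]%SET.

Definition grassmannian2 (F : fieldType) (V : vectType F) : set {vspace V} :=
  [set W : {vspace V} | \dim W = 2]%classic.

Definition flag_of_basis (F : fieldType) (V : vectType F) (m : nat)
    (e : m.-tuple V) (i : nat) : {vspace V} := <<take i e>>%VS.

Definition schubert_cycle (F : fieldType) (V : vectType F)
    (A : nat -> {vspace V}) (m : nat) (alpha : grid_point m) : set {vspace V} :=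
  [set W : {vspace V} | [/\ grassmannian2 W,
      1 <= \dim (W :&: A alpha.1)%VS & (W <= A alpha.2)%VS]]%classic.

Definition schubert_union (F : fieldType) (V : vectType F)
    (A : nat -> {vspace V}) (m : nat) (U : {set grid_point m}) : set {vspace V} :=
  (\bigcup_(alpha in [set` U]) schubert_cycle A alpha)%classic.

Definition schubert_unions (F : fieldType) (V : vectType F)
    (A : nat -> {vspace V}) (m : nat) : set (set {vspace V}) :=
  [set S | exists2 U : {set grid_point m},
     U \subset full_grid m & S = schubert_union A U]%classic.

Definition dual_space (F : fieldType) (V : vectType F) : vectType F :=
  'Hom(V, F^o).

Definition eval_at (F : fieldType) (V : vectType F) (v : V)
    (f : 'Hom(V, F^o)) : F^o := f v.

Fact eval_at_is_linear (F : fieldType) (V : vectType F) (v : V) :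
  linear (@eval_at F V v).
Proof. by move=> a f g; rewrite /eval_at add_lfunE scale_lfunE. Qed.

HB.instance Definition _ (F : fieldType) (V : vectType F) (v : V) :=
  GRing.isLinear.Build F 'Hom(V, F^o) F^o _ (@eval_at F V v)
    (@eval_at_is_linear F V v).

(* Functionals vanishing on U, cut out by a basis of U; see memv_annihilator. *)
Definition annihilator (F : fieldType) (V : vectType F) (U : {vspace V}) :
    {vspace dual_space V} :=
  (\bigcap_(v <- vbasis U) lker (linfun (@eval_at F V v)))%VS.

Lemma memv_annihilator (F : fieldType) (V : vectType F) (U : {vspace V})
    (f : 'Hom(V, F^o)) :
  reflect (forall v, v \in U -> f v = 0%R) (f \in annihilator U).
Proof.
have E : (f \in annihilator U) = all (fun v => f v == 0%R) (vbasis U).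
  rewrite /annihilator; elim: (tval (vbasis U)) => [|v s IHs] /=.
    by rewrite big_nil memvf.
  by rewrite big_cons memv_cap IHs memv_ker lfunE.
rewrite E; apply: (iffP allP) => [f0 v | f0 v vU]; last first.
  by rewrite f0 // vbasis_mem.
move=> /coord_vbasis ->; rewrite linear_sum big1 // => i _.
by rewrite linearZ /= (eqP (f0 _ _)) ?scaler0 // mem_nth ?size_tuple.
Qed.

(* The j-dimensional member of the dual flag is the annihilator of A_(m-j). *)
Definition dual_flag (F : fieldType) (V : vectType F) (m : nat)
    (A : nat -> {vspace V}) (j : nat) : {vspace dual_space V} :=
  annihilator (A (m - j)).

(* S' is the union w.r.t. the dual flag whose grid is dual to that of S. *)
Definition dual_schubert_union (F : fieldType) (V : vectType F) (m : nat)
    (A : nat -> {vspace V}) (S : set {vspace V})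
    (S' : set {vspace dual_space V}) : Prop :=
  exists U U' : {set grid_point m},
    [/\ U \subset full_grid m, U' \subset full_grid m,
        S = schubert_union A U, S' = schubert_union (dual_flag m A) U'
      & union_grid U' = dual_grid (union_grid U)].

(* mu is the (well-defined) assignment S_U |-> M_U: its value at a union does
   not depend on the family U presenting it. *)
Definition column_assignment (F : fieldType) (V : vectType F) (m : nat)
    (A : nat -> {vspace V}) (mu : set {vspace V} -> {set 'I_m.+1}) : Prop :=
  forall U : {set grid_point m}, U \subset full_grid m ->
    mu (schubert_union A U) = column_set (union_grid U).

(* Main.v *)
Require Import Defs.
From HB Require Import structures.
From mathcomp Require Import all_boot all_order all_algebra.
From mathcomp Require Import mathcomp_extra boolp classical_sets functions.
From mathcomp Require Import cardinality.
From mathcomp Require Import zify.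

Set Implicit Arguments.
Unset Strict Implicit.
Unset Printing Implicit Defensive.

(** The grids that occur are the order ideals of the set of points 1 <= x < y <= m
with the product order.  The idea is to read such an ideal along its diagonals
y - x = t instead of its columns.  The columns of an ideal are intervals
(i, i + 1), ..., (i, i + c_i), and the lengths c_1 > c_2 > ... strictly decrease
as long as they are positive.  So (i, i + t) lies in the ideal iff t <= c_i, and
the number of points on the t-th diagonal is the number of elements >= t of
the set M_U = {c_1, ..., c_r} ([diagonal_column_set]).

Everything combinatorial follows from this identity, because an ideal is
determined by its diagonal lengths (each diagonal is filled from its start,
[leq_diagonal]) and a set of positive integers is determined by the numbers of
its elements >= t ([count_geq_inj]).  Hence M_U determines the ideal.  Conversely,
from any N one builds the ideal [staircase] with these diagonal lengths; it is an
ideal because lowering the threshold t by one adds at most one element.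
Finally, the reflection (a, b) -> (m + 1 - b, m + 1 - a) preserves each diagonal,
so the t-th diagonal of the dual grid has (m - t) - #{n in M_U : n >= t} points,
which is the number of elements >= t of the complement of M_U
([column_set_dual]).

The geometry only enters in showing that a Schubert union determines its grid,
for any flag A_0 < ... < A_m with strict inclusions.  If f_i lies in A_i but not
in A_(i-1), the plane spanned by f_a and f_b lies in the cycle of (a, b) and in
no cycle of index not above (a, b) ([schubert_cycle_generic]).  Hence (a, b) is
in the grid iff the whole cycle of (a, b) is contained in the union
([grid_of_union]).  The flag of a basis and the dual flag are both strict, as the
coordinate functionals show, so the same argument serves both. *)

(** * Order ideals of the grid *)

(** Membership in terms of bare natural numbers: shifted points such as (i, i + t)
can be written down without a proof that they stay in bounds. *)
Definition cell (m : nat) (G : {set grid_point m}) (x y : nat) : bool :=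
  [exists p in G, (p.1 == x :> nat) && (p.2 == y :> nat)].

Definition ideal (m : nat) (G : {set grid_point m}) : Prop :=
  (forall x y, cell G x y -> 1 <= x < y) /\
  (forall x y x' y', cell G x y -> 1 <= x' < y' -> x' <= x -> y' <= y ->
     cell G x' y').

(** Indexing a diagonal by the first coordinate makes it, for an ideal, an initial
segment of 1, 2, ... *)
Definition diagonal (m : nat) (G : {set grid_point m}) (t : nat) : nat :=
  #|[set i : 'I_m.+1 | cell G i (i + t)]%SET|.

Definition count_geq (m : nat) (N : {set 'I_m.+1}) (t : nat) : nat :=
  #|[set k in N | t <= k]%SET|.

(** The ideal whose t-th diagonal consists of its first [count_geq N t] points, or of all
its points if there are fewer. *)
Definition staircase (m : nat) (N : {set 'I_m.+1}) : {set grid_point m} :=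
  [set p in full_grid m | p.1 <= count_geq N (p.2 - p.1)]%SET.

(** This turns the cardinals that define columns and diagonals of an ideal into
membership tests, since both are initial segments of 1, 2, ... *)
Lemma card_initial_segment (n : nat) (P : pred nat) :
  (forall j, P j -> 1 <= j <= n) ->
  (forall i j, 1 <= i <= j -> P j -> P i) ->
  forall i, 1 <= i -> (i <= #|[set j : 'I_n.+1 | P j]%SET|) = P i.
Proof.
move=> Pn Pdown i i_gt0; apply/idP/idP.
- apply: contraTT => nPi; rewrite -ltnNge.
  (* Without i, the segment is contained in {1, ..., i - 1}. *)
  pose f (k : 'I_i.-1) : 'I_n.+1 := inord k.+1.
  suff sub : ([set j : 'I_n.+1 | P j] \subset f @: [set: 'I_i.-1])%SET.
    have := leq_trans (subset_leq_card sub) (leq_imset_card _ _).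
    by rewrite cardsT card_ord; lia.
  apply/fintype.subsetP => j; rewrite inE => Pj; have jn := Pn _ Pj.
  have ji : j < i.
    by rewrite ltnNge; apply: contra nPi => ij; apply: Pdown Pj; rewrite i_gt0.
  have lt : j.-1 < i.-1 by lia.
  apply/imsetP; exists (Ordinal lt); first by rewrite inE.
  by apply: val_inj; rewrite /f /= inordK; lia.
- move=> Pi; have in_ := Pn _ Pi.
  (* With i, the segment contains {1, ..., i}. *)
  pose f (k : 'I_i) : 'I_n.+1 := inord k.+1.
  have fE k : f k = k.+1 :> nat by rewrite inordK //; have := ltn_ord k; lia.
  have f_inj : injective f.
    by move=> k l /(congr1 val) /=; rewrite !fE => -[] /val_inj.
  rewrite -[leqLHS](card_ord i) -cardsT -(card_imset _ f_inj).
  apply: subset_leq_card; apply/fintype.subsetP => _ /imsetP[k _ ->].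
  by rewrite inE fE; apply: Pdown Pi; have := ltn_ord k; lia.
Qed.

Section Grids.
Variable m : nat.
Implicit Types (G H U : {set grid_point m}) (N : {set 'I_m.+1}).

Lemma cellP G x y :
  reflect (exists2 p, p \in G & p.1 = x :> nat /\ p.2 = y :> nat) (cell G x y).
Proof.
apply: (iffP exists_inP) => -[p pG].
  by case/andP => /eqP ? /eqP ?; exists p.
by case=> <- <-; exists p; rewrite ?eqxx.
Qed.

Lemma mem_cell G p : (p \in G) = cell G p.1 p.2.
Proof.
apply/idP/cellP => [pG|[q qG []]]; first by exists p.
by case: p q qG => [a b] [c d] /= qG /val_inj <- /val_inj <-.
Qed.

Lemma cell_bound G x y : cell G x y -> x <= m /\ y <= m.
Proof. by case/cellP => p _ [<- <-]; split; rewrite -ltnS ltn_ord. Qed.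

Lemma cell_pred (P : nat -> nat -> bool) x y :
  cell [set p : grid_point m | P p.1 p.2]%SET x y = [&& x <= m, y <= m & P x y].
Proof.
apply/cellP/and3P => [[p + [<- <-]]|[xm ym Pxy]].
  by rewrite inE => ->; split=> //; rewrite -ltnS ltn_ord.
by exists (inord x, inord y); rewrite ?inE /= !inordK.
Qed.

Lemma eq_cell G H : (forall x y, cell G x y = cell H x y) -> G = H.
Proof. by move=> GH; apply/setP => p; rewrite !mem_cell. Qed.

Lemma cell_union U x y : cell (union_grid U) x y =
  (1 <= x < y) && [exists alpha in U, (x <= alpha.1) && (y <= alpha.2)].
Proof.
apply/cellP/andP => [[p /bigcupP[alpha aU]]|[xy /exists_inP[[a b] aU /= le]]].
  rewrite !inE => /andP[p12 le] [<- <-]; split=> //.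
  by apply/exists_inP; exists alpha.
have [am bm] := (ltn_ord a, ltn_ord b).
exists (inord x, inord y); last by rewrite /= !inordK //; lia.
by apply/bigcupP; exists (a, b); rewrite // !inE /= !inordK //; lia.
Qed.

Lemma union_ideal U : ideal (union_grid U).
Proof.
split=> [x y|x y x' y']; rewrite !cell_union => /andP[] // _.
move=> /exists_inP[alpha aU le] -> le1 le2.
by apply/exists_inP; exists alpha => //; lia.
Qed.

Lemma ideal_sub_full G : ideal G -> G \subset full_grid m.
Proof.
case=> Gfull _; apply/fintype.subsetP => p; rewrite mem_cell => /Gfull.
by rewrite inE.
Qed.

Lemma union_grid_id G : ideal G -> union_grid G = G.
Proof.
move=> [Gfull Gdown]; apply: eq_cell => x y; rewrite cell_union.
apply/andP/idP => [[xy /exists_inP[p pG /andP[]]]|xyG].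
  by rewrite mem_cell in pG; exact: Gdown pG xy.
split; first exact: Gfull xyG.
case/cellP: xyG => p pG [<- <-].
by apply/exists_inP; exists p; rewrite ?leqnn.
Qed.

(** The reflection is an involution, so membership in the dual grid is tested at
the reflected point. *)
Lemma cell_dual G x y :
  cell (dual_grid G) x y = ((1 <= x < y) && (y <= m)) && ~~ cell G (m.+1 - y) (m.+1 - x).
Proof.
apply/cellP/andP => [[p + [<- <-]]|[xy nG]].
  rewrite inE => /exists_inP[[a b]]; rewrite finset.in_setD mem_cell inE /=.
  have [am bm] := (ltn_ord a, ltn_ord b).
  move=> /andP[nG q12] /andP[/eqP-> /eqP->]; split; first by lia.
  by rewrite !subKn //; lia.
exists (inord x, inord y); last by rewrite /= !inordK //; lia.
rewrite inE; apply/exists_inP; exists (inord (m.+1 - y), inord (m.+1 - x)).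
  by rewrite finset.in_setD mem_cell inE /= !inordK ?nG; lia.
by rewrite /= !inordK; lia.
Qed.

Lemma dual_ideal G : ideal G -> ideal (dual_grid G).
Proof.
move=> [Gfull Gdown]; split=> [x y|x y x' y']; rewrite !cell_dual => /andP[].
  by lia.
move=> xy nG xy' le1 le2; apply/andP; split; first by lia.
by apply: contra nG => /Gdown; apply; lia.
Qed.

(** * Columns and diagonals of an ideal *)

(** Both lowering i and keeping the difference t move a point down in the
product order, so a diagonal has no gaps. *)
Lemma leq_diagonal G t i : ideal G -> 1 <= i ->
  (i <= diagonal G t) = cell G i (i + t).
Proof.
move=> [Gfull Gdown]; apply: (@card_initial_segment m (fun i => cell G i (i + t))).
- by move=> j c; have := cell_bound c; have := Gfull _ _ c; lia.
- by move=> k j kj c; apply: (Gdown _ _ _ _ c); have := Gfull _ _ c; lia.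
Qed.

Lemma leq_column G i t : ideal G -> 1 <= i -> 1 <= t ->
  (t <= column G i) = cell G i (i + t).
Proof.
move=> [Gfull Gdown] i_gt0 t_gt0.
(* Points of the column are parametrized by their height t above the line y = x. *)
have <- : #|[set t : 'I_m.+1 | cell G i (i + t)]%SET| = column G i.
  pose f (p : grid_point m) : 'I_m.+1 := inord (p.2 - p.1).
  have fE p : f p = p.2 - p.1 :> nat 
    by case: p => a b; rewrite inordK //=; have := ltn_ord b; lia.
  rewrite /column -(@card_in_imset _ _ f) => [|p q]; last first.
    rewrite !inE => /andP[pG /eqP p1] /andP[qG /eqP q1] /(congr1 val) /=.
    rewrite !fE => eq.
    move: pG qG; rewrite !mem_cell => /Gfull lp /Gfull lq.
    case: p q p1 q1 eq lp lq => [a b] [c d] /= p1 q1 eq lp lq.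
    by congr (_, _); apply: val_inj => /=; lia.
  apply: eq_card => s; apply/idP/imsetP.
    rewrite inE => /cellP[p pG [p1 p2]]; exists p.
      by rewrite !inE pG p1 /=.
    by apply: val_inj; rewrite /= fE p1 p2 addKn.
  case=> p; rewrite !inE => /andP[pG /eqP p1] ->; rewrite fE.
  rewrite mem_cell in pG; have /andP[_ /ltnW lp] := Gfull _ _ pG.
  by rewrite -p1 subnKC.
apply: (@card_initial_segment m (fun t => cell G i (i + t))) t_gt0.
- by move=> j c; have := cell_bound c; have := Gfull _ _ c; lia.
- by move=> k j kj c; apply: (Gdown _ _ _ _ c); have := Gfull _ _ c; lia.
Qed.

Lemma column0 G : ideal G -> column G 0 = 0.
Proof.
move=> [Gfull _]; apply/eqP; rewrite cards_eq0; apply/eqP/setP => p.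
rewrite !inE mem_cell; apply/negP => /andP[/Gfull + /eqP p0].
by rewrite p0.
Qed.

Lemma column_gt0 G i : ideal G -> 0 < column G i -> 0 < i /\ i + column G i <= m.
Proof.
move=> Gi; case: i => [|i]; first by rewrite column0.
move=> c_gt0; split=> //.
have := leqnn (column G i.+1); rewrite leq_column // => /cell_bound; lia.
Qed.

(** If (j, j + t) is in the ideal, so is (i, i + t + 1), which lies weakly below it:
i < j gives i + t + 1 <= j + t. *)
Lemma column_decr G i j : ideal G -> 0 < i < j -> 0 < column G j ->
  column G j < column G i.
Proof.
move=> Gi ij c_gt0; rewrite leq_column //; last by lia.
have := leqnn (column G j); rewrite leq_column //; last by lia.
by move/(proj2 Gi); apply; lia.
Qed.

(** Since column lengths decrease, the positive columns are exactly the first r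
of them, so the prefix condition in [column_set] is automatic. *)
Lemma mem_column_set G (k : 'I_m.+1) : ideal G ->
  reflect (exists2 i : 'I_m.+1, 0 < column G i & k = column G i :> nat)
          (k \in column_set G).
Proof.
move=> Gi; rewrite inE; apply: (iffP existsP) => [[r]|[i ci kE]].
  case/and3P => /forallP pos _ /existsP[i /andP[ir /eqP kE]].
  by exists i => //; have := pos i; rewrite ir.
(* r is the last positive column, or 0 if there is none. *)
pose nice (r : 'I_m.+1) := (r == ord0) || (0 < column G r).
have nice0 : nice ord0 by rewrite /nice eqxx.
case: (arg_maxnP (fun r : 'I_m.+1 => r : nat) nice0) => r nr rmax.
have ir : 1 <= i <= r.
  have [-> _] := column_gt0 Gi ci.
  by apply: rmax; rewrite /nice ci orbT.
have cr : 0 < column G r.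
  by case/orP: nr ir => [/eqP->|//] /=; case: (nat_of_ord i).
exists r; apply/and3P; split.
- apply/forallP => j; apply/implyP => /andP[j1]; rewrite leq_eqVlt.
  case/orP => [/eqP->//|jr].
  by apply: leq_trans cr (ltnW (column_decr Gi _ cr)); rewrite j1.
- apply/forallP => j; apply/implyP => rj; rewrite -leqn0 leqNgt.
  by apply/negP => cj; have := rmax j; rewrite /nice cj orbT => /(_ isT); lia.
- by apply/existsP; exists i; rewrite ir kE eqxx.
Qed.

Lemma column_set_sub G : ideal G -> column_set G \subset M_full m.
Proof.
move=> Gi; apply/fintype.subsetP => k /(mem_column_set _ Gi)[i ci kE].
by rewrite inE kE; have := column_gt0 Gi ci; lia.
Qed.

(** The point (i, i + t) is in the ideal iff the i-th column has length at least t,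
and distinct positive columns have distinct lengths; so i -> column G i is a
bijection from the t-th diagonal to the elements >= t of the column set. *)
Lemma diagonal_column_set G t : ideal G -> 1 <= t ->
  diagonal G t = count_geq (column_set G) t.
Proof.
move=> Gi t_gt0; rewrite /diagonal /count_geq.
pose f (i : 'I_m.+1) : 'I_m.+1 := inord (column G i).
have fE i : f i = column G i :> nat.
  rewrite inordK // ltnS; case: (posnP (column G i)) => [->//|c].
  by have := column_gt0 Gi c; lia.
have cE (i : 'I_m.+1) : cell G i (i + t) = (t <= column G i).
  case: (posnP i) => [->|i_gt0]; last by rewrite leq_column.
  rewrite column0 // leqNgt t_gt0 /=.
  by case c: (cell _ _ _) => //; have := proj1 Gi _ _ c.
have -> : ([set k in column_set G | t <= k] =
           f @: [set i : 'I_m.+1 | cell G i (i + t)])%SET.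
  apply/setP => k; rewrite inE; apply/andP/imsetP.
    case=> /(mem_column_set _ Gi)[i ci kE] tk; exists i.
      by rewrite inE cE -kE.
    by apply: val_inj; rewrite /= fE.
  case=> i; rewrite inE cE => ti ->; rewrite fE; split=> //.
  by apply/(mem_column_set _ Gi); exists i; rewrite ?fE //; lia.
rewrite card_in_imset // => i j; rewrite !inE !cE => ci cj /(congr1 val) /=.
rewrite !fE => eq; apply: val_inj => /=.
have [i1 _] := column_gt0 Gi (leq_trans t_gt0 ci).
have [j1 _] := column_gt0 Gi (leq_trans t_gt0 cj).
case: (ltngtP i j) => // lt.
  by have := @column_decr G i j Gi; lia.
by have := @column_decr G j i Gi; lia.
Qed.

Lemma ideal_eq G H : ideal G -> ideal H ->
  (forall t, 1 <= t -> diagonal G t = diagonal H t) -> G = H.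
Proof.
move=> Gi Hi eq; apply: eq_cell => x y.
have [xy|nxy] := boolP (1 <= x < y); last first.
  by apply/idP/idP => [/(proj1 Gi)|/(proj1 Hi)]; rewrite (negPf nxy).
have -> : y = x + (y - x) by lia.
by rewrite -!leq_diagonal ?eq //; lia.
Qed.

(** * Sets of integers and their threshold counts *)

Lemma count_geqS N (k : 'I_m.+1) : count_geq N k = (k \in N) + count_geq N k.+1.
Proof.
rewrite /count_geq (cardsD1 k) inE leqnn andbT; congr (_ + _).
apply: eq_card => l; rewrite !inE.
rewrite [k.+1 <= l]ltn_neqAle -val_eqE /= [nat_of_ord l == _]eq_sym.
by case: (l \in N); rewrite ?andbF.
Qed.

(** k belongs to N iff the counts at the thresholds k and k + 1 differ. *)
Lemma count_geq_inj N N' : N \subset M_full m -> N' \subset M_full m ->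
  (forall t, 1 <= t -> count_geq N t = count_geq N' t) -> N = N'.
Proof.
move=> NM NM' eq; apply/setP => k.
have [k0|k_gt0] := posnP k.
  have nM : k \notin M_full m by rewrite inE k0.
  by rewrite (contraNF (fintype.subsetP NM k)) ?(contraNF (fintype.subsetP NM' k)).
have := eq _ k_gt0; rewrite !count_geqS eq // => /addIn.
by do 2!case: (_ \in _).
Qed.

(** There is at most one element of N between consecutive thresholds. *)
Lemma count_geq_lipschitz N t s : count_geq N t <= count_geq N (t + s) + s.
Proof.
elim: s => [|s IHs]; first by rewrite !addn0.
apply: leq_trans IHs _; rewrite !addnS -addSn leq_add2r.
have [le|lt] := leqP (t + s) m.
  have -> : t + s = Ordinal (le : t + s < m.+1) by [].
  by rewrite count_geqS; case: (_ \in _).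
rewrite leqW // subset_leq_card //; apply/fintype.subsetP => k; rewrite !inE => /andP[_].
by have := ltn_ord k; lia.
Qed.

Lemma count_geq_antitone N s t : s <= t -> count_geq N t <= count_geq N s.
Proof.
move=> st; apply: subset_leq_card; apply/fintype.subsetP => k; rewrite !inE => /andP[-> /=].
exact: leq_trans.
Qed.

Lemma cell_staircase N x y :
  cell (staircase N) x y = ((1 <= x < y) && (y <= m)) && (x <= count_geq N (y - x)).
Proof.
rewrite (_ : staircase N =
  [set p : grid_point m | (1 <= p.1 < p.2) && (p.1 <= count_geq N (p.2 - p.1))]%SET).
  by rewrite (cell_pred (fun x y => (1 <= x < y) && (x <= count_geq N (y - x)))) /=; lia.
by apply/setP => p; rewrite !inE.
Qed.

(** Moving x down by s raises y - x by at most s, which costs at most s in the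
count, while the bound x has also dropped by s. *)
Lemma staircase_ideal N : ideal (staircase N).
Proof.
split=> [x y|x y x' y']; rewrite !cell_staircase => /andP[xy xN]; first by lia.
move=> xy' lex ley; apply/andP; split; first by lia.
have := count_geq_lipschitz N (y - x) (x - x').
have : count_geq N (y - x + (x - x')) <= count_geq N (y' - x') by apply: count_geq_antitone; lia.
lia.
Qed.

(** The reflection k -> m - k exchanges the elements >= t of {1, ..., m - 1} with
the abscissas {1, ..., m - t} of the t-th diagonal of the full grid. *)
Lemma count_geq_full t : 1 <= t ->
  count_geq (M_full m) t = #|[set i : 'I_m.+1 | 1 <= i <= m - t]%SET|.
Proof.
move=> t_gt0; rewrite /count_geq -(card_imset _ rev_ord_inj); apply: eq_card => i.
rewrite -[i]rev_ordK mem_imset; last exact: rev_ord_inj.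
rewrite !inE !(rev_ordK, inE) /=; have := ltn_ord i; lia.
Qed.

Lemma count_geq_bound N t : N \subset M_full m -> 1 <= t -> count_geq N t <= m - t.
Proof.
move=> NM t_gt0; apply: (@leq_trans (count_geq (M_full m) t)).
  apply: subset_leq_card; apply/fintype.subsetP => k; rewrite !inE => /andP[/(fintype.subsetP NM)].
  by rewrite inE => -> ->.
rewrite leqNgt count_geq_full //.
rewrite (@card_initial_segment _ (fun i => 1 <= i <= m - t)); lia.
Qed.

(** The t-th diagonal of the full grid has m - t points, so it has room for the
[count_geq N t] prescribed ones. *)
Lemma diagonal_staircase N t : N \subset M_full m -> 1 <= t ->
  diagonal (staircase N) t = count_geq N t.
Proof.
move=> NM t_gt0; have le := count_geq_bound NM t_gt0.
have E i : 1 <= i -> (i <= diagonal (staircase N) t) = (i <= count_geq N t).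
  move=> i1; rewrite leq_diagonal //; last exact: staircase_ideal.
  rewrite cell_staircase addKn; lia.
apply/eqP; rewrite eqn_leq.
move: (E (count_geq N t)) (E (diagonal (staircase N) t)); lia.
Qed.

(** * Bijectivity and duality for column sets *)

Lemma column_set_staircase N : N \subset M_full m -> column_set (staircase N) = N.
Proof.
move=> NM; have Gi := staircase_ideal N.
apply: count_geq_inj => // [|t t1]; first exact: column_set_sub.
by rewrite -diagonal_column_set // diagonal_staircase.
Qed.

Lemma column_set_inj G H : ideal G -> ideal H ->
  column_set G = column_set H -> G = H.
Proof.
move=> Gi Hi eq; apply: ideal_eq => // t t1.
by rewrite !diagonal_column_set // eq.
Qed.

Lemma count_geqD N N' t : N' \subset N -> count_geq (N :\: N')%SET t = count_geq N t - count_geq N' t.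
Proof.
move=> sub; rewrite /count_geq -cardsDS.
  apply: eq_card => k; rewrite !inE.
  by case: (k \in N); case: (k \in N'); case: (t <= k).
apply/fintype.subsetP => k; rewrite !inE => /andP[kN ->].
by rewrite (fintype.subsetP sub).
Qed.

(** The reflection sends the i-th point of the t-th diagonal to its point number
m + 1 - t - i, and the dual grid keeps the points that G leaves out. *)
Lemma diagonal_dual G t : ideal G -> 1 <= t ->
  diagonal (dual_grid G) t = count_geq (M_full m) t - diagonal G t.
Proof.
move=> Gi t1; rewrite count_geq_full // /diagonal -cardsDS; last first.
  apply/fintype.subsetP => i; rewrite !inE => c.
  by have := cell_bound c; have := proj1 Gi _ _ c; lia.
pose f (i : 'I_m.+1) : 'I_m.+1 := inord (m.+1 - t - i).
have fE i : f i = m.+1 - t - i :> nat by rewrite inordK // ltnS; lia.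
rewrite -[RHS](card_in_imset (f := f)) => [|i j]; last first.
  rewrite !inE => /andP[_ le_i] /andP[_ le_j] /(congr1 val) /=; rewrite !fE => eq.
  by apply: val_inj => /=; lia.
apply: eq_card => i; rewrite inE cell_dual; apply/idP/imsetP.
- move=> /andP[le_i nG]; exists (f i); last by apply: val_inj; rewrite /= !fE; lia.
  rewrite !inE fE; apply/andP; split; last by lia.
  apply: contra nG; congr (cell G _ _); lia.
- case=> j; rewrite !inE => /andP[nG le_j] ->; rewrite fE; apply/andP; split; first by lia.
  apply: contra nG; congr (cell G _ _); lia.
Qed.

Lemma column_set_dual G : ideal G ->
  column_set (dual_grid G) = (M_full m :\: column_set G)%SET.
Proof.
move=> Gi; have Di := dual_ideal Gi; have GM := column_set_sub Gi.
apply: count_geq_inj => [||t t1]; first exact: column_set_sub.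
  exact: subsetDl.
by rewrite count_geqD // -!diagonal_column_set // diagonal_dual.
Qed.

Lemma card_M_full : #|M_full m| = m - 1.
Proof.
have -> : #|M_full m| = count_geq (M_full m) 1.
  by apply: eq_card => k; rewrite !inE; case: (1 <= k); rewrite ?andbF ?andbT.
rewrite count_geq_full //; apply/eqP; rewrite eqn_leq.
have E := @card_initial_segment m (fun i => 1 <= i <= m - 1).
apply/andP; split.
  by rewrite leqNgt E; lia.
case: (m) E => [|[|n]] // E; rewrite E; lia.
Qed.

End Grids.

(** * A Schubert union determines its grid *)

Lemma memvZ_out (F : fieldType) (V : vectType F) (U : {vspace V}) v k :
  v \notin U -> (k *: v)%R \in U -> k = 0%R.
Proof.
move=> vU kvU; apply: contraNeq vU => k_neq0.
by rewrite -(GRing.scalerK k_neq0 v) memvZ.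
Qed.

Section Flags.
Variables (F : fieldType) (V : vectType F) (m : nat) (A : nat -> {vspace V}).
Hypothesis A_mono : forall i j, i <= j -> (A i <= A j)%VS.
Hypothesis A_strict : forall i, 1 <= i <= m -> exists2 v, v \in A i & v \notin A i.-1.

Lemma schubert_cycle_mono (p q : grid_point m) : p.1 <= q.1 -> p.2 <= q.2 ->
  (schubert_cycle A p `<=` schubert_cycle A q)%classic.
Proof.
move=> le1 le2 W [W2 W1 WA]; split=> //.
  by apply: leq_trans W1 (dimvS _); apply: capvS => //; apply: A_mono.
exact: subv_trans WA (A_mono le2).
Qed.

(** The witness is the plane spanned by v in A_a outside A_(a-1) and w in A_b outside
A_(b-1).  If it lies in A_d, then w does, so b <= d.  If c < a and u = k w + l v
is in A_c, then k = 0 because v and u lie in A_(b-1), and then l = 0 because u lies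
in A_(a-1); so the plane meets A_c trivially. *)
Lemma schubert_cycle_generic (p : grid_point m) : p \in full_grid m ->
  exists2 W, schubert_cycle A p W &
    forall q : grid_point m, schubert_cycle A q W -> (p.1 <= q.1) && (p.2 <= q.2).
Proof.
case: p => a b; rewrite inE /= => ab; have bm := ltn_ord b.
have [v va nva] : exists2 v, v \in A a & v \notin A a.-1 by apply: A_strict; lia.
have [w wb nwb] : exists2 w, w \in A b & w \notin A b.-1 by apply: A_strict; lia.
have v_neq0 : v != 0%R by apply: contraNneq nva => ->; rewrite mem0v.
have vb : v \in A b.-1 by apply: subvP va; apply: A_mono; lia.
have Wfree : free [:: w; v].
  rewrite free_cons span_seq1 seq1_free v_neq0 andbT.
  apply: contra nwb => /vlineP[k ->]; exact: memvZ.
exists <<[:: w; v]>>%VS.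
  split; first exact/eqP.
    rewrite lt0n dimv_eq0 -subv0; apply: contra v_neq0 => /subvP/(_ v).
    by rewrite memv0; apply; rewrite memv_cap va memv_span // !inE eqxx orbT.
  apply/span_subvP => u; rewrite !inE => /orP[] /eqP-> //=.
  by apply: subvP vb; apply: A_mono; exact: leq_pred.
case=> c d [_ /= W1 Wd]; apply/andP; split; rewrite leqNgt; apply/negP => lt.
- move: W1; rewrite lt0n dimv_eq0 -vpick0; set u := vpick _.
  have : u \in (<<[:: w; v]>> :&: A c)%VS by exact: memv_pick.
  rewrite memv_cap span_cons span_seq1 => /andP[/memv_addP[_ /vlineP[k ->]]].
  case=> _ /vlineP[l ->] uE uA.
  have k0 : k = 0%R.
    apply: (memvZ_out nwb); rewrite (_ : _ *: _ = u - l *: v)%R.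
      by apply: memvB; [apply: subvP uA; apply: A_mono; lia | exact: memvZ].
    by rewrite uE GRing.addrK.
  rewrite k0 GRing.scale0r GRing.add0r in uE.
  have l0 : l = 0%R.
    by apply: (memvZ_out nva); rewrite -uE; apply: subvP uA; apply: A_mono; lia.
  by rewrite uE l0 GRing.scale0r eqxx.
- move/negP: nwb; apply; apply: (subvP (A_mono (_ : d <= b.-1))); first by lia.
  by apply: (subvP Wd); rewrite memv_span // inE eqxx.
Qed.

(** Defined from the set of planes alone, so that it cannot depend on a family
presenting the union. *)
Definition grid_of (S : set {vspace V}) : {set grid_point m} :=
  [set p in full_grid m | `[< (schubert_cycle A p `<=` S)%classic >]]%SET.

Lemma grid_of_union (U : {set grid_point m}) : grid_of (schubert_union A U) = union_grid U.
Proof.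
apply/setP => p; rewrite inE; apply/andP/bigcupP => [[pm /asboolP sub]|].
  have [W Wp Wgen] := schubert_cycle_generic pm.
  have [alpha aU Wa] := sub _ Wp.
  by exists alpha => //; rewrite inE pm Wgen.
case=> alpha aU; rewrite inE => /andP[pm /andP[le1 le2]]; split=> //.
apply/asboolP => W Wp; exists alpha => //.
exact: schubert_cycle_mono Wp.
Qed.

(** A union is presented by its whole grid, hence unions with the same grid are
equal. *)
Lemma schubert_union_grid (U : {set grid_point m}) : U \subset full_grid m ->
  schubert_union A (union_grid U) = schubert_union A U.
Proof.
move=> Um; apply/seteqP; split=> W [alpha aU Wa].
  have /bigcupP[beta bU] := aU; rewrite inE => /andP[_ /andP[le1 le2]].
  by exists beta => //; exact: schubert_cycle_mono Wa.
exists alpha => //; apply/bigcupP; exists alpha => //.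
by rewrite inE !leqnn (fintype.subsetP Um).
Qed.

End Flags.

(** * The flag of a basis and the dual flag *)

Section BasisFlag.
Variables (F : fieldType) (V : vectType F) (m : nat) (e : m.-tuple V).
Hypothesis he : basis_of fullv e.

(** The coordinate along the basis vector number k (counted from 0) separates A_k from
A_(k+1): this gives strictness of the flag and, being itself a functional, of the
dual flag. *)
Lemma coordinate_functional k : k < m -> exists2 f : 'Hom(V, F^o),
  {in flag_of_basis e k, forall v, f v = 0%R} & f (e`_k)%R = 1%R.
Proof.
move=> km; pose K := Ordinal km; have efree := basis_free he.
pose f : 'Hom(V, F^o) := linfun (coord e K : V -> F^o).
have fE (j : 'I_m) : f (e`_j)%R = (j == K)%:R%R by rewrite lfunE /= coord_free.
exists f; last by rewrite (fE K) eqxx.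
move=> v vA; apply/eqP; rewrite -memv_ker; apply: subvP vA; apply/span_subvP => {}v.
move=> /(nthP 0%R)[j]; rewrite size_takel ?size_tuple; last exact: ltnW.
move=> jk <-.
rewrite nth_take // memv_ker (fE (Ordinal (ltn_trans jk km))).
by rewrite -val_eqE /= ltn_eqF.
Qed.

Lemma flag_of_basis_mono i j : i <= j -> (flag_of_basis e i <= flag_of_basis e j)%VS.
Proof.
move=> ij; apply: sub_span; rewrite -(subnKC ij) takeD.
by move=> v; rewrite mem_cat => ->.
Qed.

Lemma flag_of_basis_nth k : k < m -> (e`_k)%R \in flag_of_basis e k.+1.
Proof.
move=> km; apply: memv_span; rewrite (take_nth 0%R) ?size_tuple //.
by rewrite mem_rcons inE eqxx.
Qed.

Lemma flag_of_basis_strict i : 1 <= i <= m ->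
  exists2 v, v \in flag_of_basis e i & v \notin flag_of_basis e i.-1.
Proof.
case: i => // k km; exists (e`_k)%R; first exact: flag_of_basis_nth.
have [f f0 f1] := coordinate_functional km.
apply/negP => /f0; rewrite f1 => /eqP; apply/negP; exact: GRing.oner_neq0.
Qed.

Local Notation B := (dual_flag m (flag_of_basis e)).

Lemma dual_flag_mono i j : i <= j -> (B i <= B j)%VS.
Proof.
move=> ij; apply/subvP => f /memv_annihilator f0; apply/memv_annihilator => v vj.
by apply: f0; apply: subvP vj; apply: flag_of_basis_mono; rewrite leq_sub2l.
Qed.

Lemma dual_flag_strict i : 1 <= i <= m -> exists2 f, f \in B i & f \notin B i.-1.
Proof.
move=> im; have km : m - i < m by lia.
have [f f0 f1] := coordinate_functional km.
exists f; first exact/memv_annihilator.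
apply/negP => /memv_annihilator /(_ (e`_(m - i))%R); rewrite f1.
rewrite (_ : m - i.-1 = (m - i).+1); last by lia.
move=> /(_ (flag_of_basis_nth km)) /eqP; apply/negP; exact: GRing.oner_neq0.
Qed.
End BasisFlag.

(** * The classification of Schubert unions *)

Lemma card_subsets (T : finType) (M : {set T}) :
  ([set N : {set T} | N \subset M]%classic #= `I_(2 ^ #|M|))%card.
Proof.
have enumE N : (N \in enum (powerset M)) = (N \subset M).
  by rewrite mem_enum powersetE.
rewrite -card_powerset cardE; apply/card_set_bijP.
exists (index^~ (enum (powerset M))); split.
- by move=> N /= NM; rewrite index_mem enumE.
- move=> N N' /set_mem /=; rewrite -enumE => NM _ eqi.
  by rewrite -(nth_index finset.set0 NM) eqi nth_index // -index_mem -eqi index_mem.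
- move=> k /= kM; have NM := mem_nth finset.set0 kM.
  exists (nth finset.set0 (enum (powerset M)) k).
    by rewrite /= -enumE.
  by rewrite index_uniq ?enum_uniq.
Qed.

Theorem mainTheorem7 (F : fieldType) (V : vectType F) (m : nat)
    (e : m.-tuple V) (hm : (3 <= m)%N) (he : basis_of fullv e) :
  exists (mu : set {vspace V} -> {set 'I_m.+1})
         (mu' : set {vspace dual_space V} -> {set 'I_m.+1}),
    let A := flag_of_basis e in
    [/\ column_assignment A mu /\ column_assignment (dual_flag m A) mu',
        set_bij (schubert_unions A m)
          [set N : {set 'I_m.+1} | N \subset M_full m]%classic mu,
        (schubert_unions A m #= `I_(2 ^ (m - 1)))%card,
        forall S : set {vspace V}, schubert_unions A m S ->
          exists! S' : set {vspace dual_space V}, dual_schubert_union m A S S'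
      & forall (S : set {vspace V}) (S' : set {vspace dual_space V}),
          dual_schubert_union m A S S' -> mu' S' = (M_full m :\: mu S)%SET].
Proof.
have Amono := @flag_of_basis_mono _ _ _ e.
have Astrict := flag_of_basis_strict he.
have Bmono := @dual_flag_mono _ _ _ e.
have Bstrict := dual_flag_strict he.
pose A := flag_of_basis e; pose B := dual_flag m A.
have gridA (U : {set grid_point m}) : grid_of m A (schubert_union A U) = union_grid U.
  exact: grid_of_union.
have gridB (U : {set grid_point m}) : grid_of m B (schubert_union B U) = union_grid U.
  exact: grid_of_union.
pose mu S := column_set (grid_of m A S).
pose mu' S := column_set (grid_of m B S).
have bij : set_bij (schubert_unions A m)
    [set N : {set 'I_m.+1} | N \subset M_full m]%classic mu.
  split.
  - by move=> _ [U _ ->] /=; rewrite /mu gridA; exact: column_set_sub (union_ideal U).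
  - move=> _ _ /set_mem[U Um ->] /set_mem[U' Um' ->]; rewrite /mu !gridA.
    move/(column_set_inj (union_ideal U) (union_ideal U')) => eqG.
    by rewrite -(schubert_union_grid Amono Um) eqG (schubert_union_grid Amono).
  - move=> N /= NM; have Gi := staircase_ideal N.
    exists (schubert_union A (staircase N)).
      by exists (staircase N) => //; exact: ideal_sub_full.
    by rewrite /mu gridA union_grid_id // column_set_staircase.
exists mu, mu'; split=> //.
- by split=> U Um; rewrite /mu /mu' ?gridA ?gridB.
- rewrite -card_M_full; apply: card_eq_trans (card_subsets _).
  have [mu_fun mu_inj mu_surj] := bij.
  have <- : (mu @` schubert_unions A m =
             [set N : {set 'I_m.+1} | N \subset M_full m])%classic.
    by apply/seteqP; split=> // _ [S SU <-]; exact: mu_fun.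
  by rewrite card_eq_sym; exact: inj_card_eq.
- move=> _ [U Um ->]; have Di := dual_ideal (union_ideal U).
  exists (schubert_union B (dual_grid (union_grid U))); split.
    exists U, (dual_grid (union_grid U)); split=> //; last exact: union_grid_id.
    exact: ideal_sub_full.
  (* Another presentation of the same union has the same grid, hence the same dual grid. *)
  move=> _ [U1 [U' [_ U'm eqS -> eqU']]].
  rewrite -(schubert_union_grid Bmono U'm) eqU'.
  by rewrite -(gridA U) eqS gridA.
- move=> _ _ [U [U' [Um U'm -> -> eqU']]].
  by rewrite /mu /mu' gridA gridB eqU' column_set_dual //; exact: union_ideal.
Qed.
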